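(* Let $k\ge1$ and $P(z)=a_kz^k+a_{k-1}z^{k-1}+\cdots+a_1z+1\in\mathbb{Z}[z]$ with $a_k\neq0$. A map $\varphi:\Omega_P\to\Omega_P$ is a strong automorphism if and only if there exists a $k\times k$ integer matrix $B$ with $\det B=\pm1$ and $BM_P=M_PB$ such that for all $x=(x_n;n\in\mathbb{Z})\in\Omega_P$, writing $\varphi(x)=(y_n;n\in\mathbb{Z})$, one has $(y_{n+1},y_{n+2},\dots,y_{n+k})^T=B\,(x_{n+1},x_{n+2},\dots,x_{n+k})^T$ in $\mathbb{T}^k$ for every $n\in\mathbb{Z}$.
   Context: Let $\mathbb{T}=\mathbb{R}/\mathbb{Z}$ and $\Omega_P=\{x\in\mathbb{T}^{\mathbb{Z}}:x_i+a_1x_{i-1}+\cdots+a_kx_{i-k}=0\ \forall i\in\mathbb{Z}\}$ (the kernel of convolution by $P$), which equals the set of $x\in\mathbb{T}^{\mathbb{Z}}$ with $(x_{n+1},\dots,x_{n+k})^T=M_P(x_n,\dots,x_{n+k-1})^T$ for all $n$, where $M_P$ is the $k\times k$ companion matrix with ones on the superdiagonal, zeros elsewhere in the first $k-1$ rows, and last row $(-a_k,-a_{k-1},\dots,-a_1)$. Integer matrices act on $\mathbb{T}^k$ in the natural way. Let $\sigma$ be the shift. An automorphism of $\Omega_P$ is an isomorphism of topological groups $\varphi:\Omega_P\to\Omega_P$ with $\varphi\circ\sigma=\sigma\circ\varphi$. It is a strong automorphism if, whenever $\varphi(x)=y$, the one-sided sequence $(y_n;n\ge0)$ is determined by $(x_n;n\ge0)$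 and $(x_n;n\ge0)$ is determined by $(y_n;n\ge0)$. *)

(* Defs.v *)
(* Written against MathComp and MathComp-Analysis. *)
From HB Require Import structures.
From mathcomp Require Import all_boot all_order all_algebra.
From mathcomp Require Import generic_quotient ring_quotient.
From mathcomp Require Import all_classical reals topology normedtype.

Set Implicit Arguments.
Unset Strict Implicit.
Unset Printing Implicit Defensive.

Import Order.TTheory GRing.Theory Num.Theory numFieldNormedType.Exports.

Local Open Scope classical_set_scope.
Local Open Scope ring_scope.
Local Open Scope quotient_scope.

(* T = R / Z: Num.int_num_subdef is the predicate underlying Num.int, the one
   carrying the additive subgroup structure. *)
Definition circle (R : realType) :=
  Quotient.quot (GRing.ZmodClosed.clone R (@Num.int_num_subdef R) _).

HB.instance Definition _ R := GRing.Zmodule.on (circle R).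
HB.instance Definition _ R := ZmodQuotient.on (circle R).
(* The quotient topology, transported by hand because the choiceType structure
   of quotient_topology is not the one underlying the zmodType of T. *)
HB.instance Definition _ R :=
  @isOpenTopological.Build (circle R)
    (@quotient_open R (circle R))
    (@openT (quotient_topology (circle R)))
    (@openI (quotient_topology (circle R)))
    (fun I f fo => @bigcup_open (quotient_topology (circle R)) I setT f
                     (fun i _ => fo i)).

Lemma circle_pi_nbhs (R : realType) (a : R) (A : set R) :
  nbhs a A -> nbhs (\pi_(circle R) a) (\pi_(circle R) @` A).
Proof.
rewrite nbhsE => -[B [oB Ba] BA]; rewrite nbhsE; exists (\pi_(circle R) @` B).
  split; last by exists a.
  rewrite /open /= /quotient_open.
  rewrite (_ : _ @^-1` _ = \bigcup_(n : int) ((fun x => x + n%:~R) @^-1` B)).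
    apply: bigcup_open => n _; apply: open_comp => // x _.
    exact: (@continuousD _ _ _ id (cst _) x (@cvg_id _ _) (@cvg_cst _ _ _ _ _)).
  apply/seteqP; split => x /= => [[y By yx]|[n _ Bxn]].
    have : y == x %[mod circle R] by apply/eqP.
    by rewrite -Quotient.idealrBE => /intrP[n yxn]; exists n; rewrite //= -yxn addrC subrK.
  exists (x + n%:~R) => //; apply/eqP; rewrite -Quotient.idealrBE addrAC subrr add0r.
  exact: intr_int.
by move=> _ [x Bx <-]; exists x => //; exact: BA.
Qed.

Lemma circle_sub_continuous (R : realType) :
  continuous (fun z : circle R * circle R => z.1 - z.2).
Proof.
move=> [p q] U /=; rewrite -[p]reprK -[q]reprK; set a := repr p; set b := repr q.
rewrite -raddfB => /(pi_continuous (Q0 := circle R)) abU.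
have : (z.1 - z.2) @[z --> (a, b)] --> a - b.
  by apply: (@cvgB _ R^o); [exact: cvg_fst|exact: cvg_snd].
move=> /(_ _ abU)[[A B] /= [aA bB] ABU].
exists (\pi_(circle R) @` A, \pi_(circle R) @` B) => /=.
  by split; exact: circle_pi_nbhs.
by move=> [_ _] /= [[x Ax <-] [y By <-]]; rewrite -raddfB; exact: (ABU (x, y)).
Qed.
HB.instance Definition _ R :=
  PreTopologicalNmodule_isTopologicalZmodule.Build (circle R)
    (@circle_sub_continuous R).

(* T^Z; addition is pointwise and {ptws _ -> _} is the product topology. *)
Definition bisequence (R : realType) := {ptws int -> circle R}.
HB.instance Definition _ R := Topological.on (bisequence R).
HB.instance Definition _ R :=
  GRing.Zmodule.copy (bisequence R) (int -> circle R).

Lemma bisequence_continuousP (R : realType) (X : topologicalType)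
    (f : X -> bisequence R) :
  (forall n, continuous (fun x => f x n)) -> continuous f.
Proof.
move=> cf x; apply/cvg_sup => n U [_ [[B oB <-] Bfx] BU].
by apply: filterS BU _; apply: cf; apply: open_nbhs_nbhs.
Qed.

Lemma bisequence_coord_continuous (R : realType) (n : int) :
  continuous (fun x : bisequence R => x n).
Proof. exact: (@proj_continuous _ (fun _ : int => circle R) n). Qed.

Lemma bisequence_sub_continuous (R : realType) :
  continuous (fun z : bisequence R * bisequence R => z.1 - z.2).
Proof.
apply: (@bisequence_continuousP R (bisequence R * bisequence R)%type
  (fun z => z.1 - z.2)) => n [x y].
have cx : (fun z : bisequence R * bisequence R => z.1 n) @ (x, y) --> x n.
  have -> : (fun z : bisequence R * bisequence R => z.1 n) =
    (fun x : bisequence R => x n) \o fst by [].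
  by apply: cvg_comp; [exact: cvg_fst | exact: bisequence_coord_continuous].
have cy : (fun z : bisequence R * bisequence R => z.2 n) @ (x, y) --> y n.
  have -> : (fun z : bisequence R * bisequence R => z.2 n) =
    (fun x : bisequence R => x n) \o snd by [].
  by apply: cvg_comp; [exact: cvg_snd | exact: bisequence_coord_continuous].
have -> : (fun z : bisequence R * bisequence R => (z.1 - z.2) n) =
  (fun w : circle R * circle R => w.1 - w.2) \o
    (fun z : bisequence R * bisequence R => (z.1 n, z.2 n)) by [].
apply: cvg_comp (cvg_pair cx cy) _.
exact: (@circle_sub_continuous R (x n, y n)).
Qed.
HB.instance Definition _ R :=
  PreTopologicalNmodule_isTopologicalZmodule.Build (bisequence R)
    (@bisequence_sub_continuous R).

Definition convolution_kernel (R : realType) (P : {poly int}) :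
    set (bisequence R) :=
  [set x | forall i : int, \sum_(j < size P) x (i - j%:Z) *~ P`_j = 0].
Arguments convolution_kernel : clear implicits.

Definition Omega_pred (R : realType) (P : {poly int}) : pred (bisequence R) :=
  fun x => x \in convolution_kernel R P.
Arguments Omega_pred : clear implicits.

Lemma Omega_zmod_closed (R : realType) (P : {poly int}) :
  zmod_closed (Omega_pred R P).
Proof.
split=> [|x y /set_mem xP /set_mem yP]; apply: mem_set => i.
  by rewrite big1 // => j _; exact: mul0rz.
under eq_bigr => j _ do rewrite [(x - y) _]/(x _ - y _) mulrzBl.
by rewrite sumrB xP yP subrr.
Qed.
HB.instance Definition _ R P :=
  GRing.isZmodClosed.Build (bisequence R) (Omega_pred R P)
    (@Omega_zmod_closed R P).

(* set_type carries the subspace topology. *)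
Definition Omega (R : realType) (P : {poly int}) :=
  set_type (convolution_kernel R P).
HB.instance Definition _ R P := Topological.on (@Omega R P).
HB.instance Definition _ R P := SubType.copy (@Omega R P) {x | Omega_pred R P x}.
HB.instance Definition _ R P := [SubChoice_isSubZmodule of @Omega R P by <:].

Lemma Omega_sub_continuous (R : realType) (P : {poly int}) :
  continuous (fun z : Omega R P * Omega R P => z.1 - z.2).
Proof.
apply: (@continuous_comp_initial _ _ _ (fun x : Omega R P => \val x)) => -[x y].
have valc (u : Omega R P) : (fun x : Omega R P => \val x) @ u --> \val u.
  exact: (@initial_continuous _ _ (set_val : Omega R P -> bisequence R)).
have -> : (fun x : Omega R P => \val x) \o (fun z => z.1 - z.2) =
    (fun w : bisequence R * bisequence R => w.1 - w.2) \o
    (fun z : Omega R P * Omega R P => (\val z.1, \val z.2)).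
  apply/funext => z; exact: (raddfB (\val : Omega R P -> bisequence R)).
have cx : (fun z : Omega R P * Omega R P => \val z.1) @ (x, y) --> \val x.
  have -> : (fun z : Omega R P * Omega R P => \val z.1) =
    (fun x : Omega R P => \val x) \o fst by [].
  by apply: cvg_comp (valc x); exact: cvg_fst.
have cy : (fun z : Omega R P * Omega R P => \val z.2) @ (x, y) --> \val y.
  have -> : (fun z : Omega R P * Omega R P => \val z.2) =
    (fun x : Omega R P => \val x) \o snd by [].
  by apply: cvg_comp (valc y); exact: cvg_snd.
apply: cvg_comp (cvg_pair cx cy) _.
exact: (@bisequence_sub_continuous R (\val x, \val y)).
Qed.

HB.instance Definition _ R P :=
  PreTopologicalNmodule_isTopologicalZmodule.Build (Omega R P)
    (@Omega_sub_continuous R P).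

Definition Omega_coord (R : realType) (P : {poly int}) (x : Omega R P) :
  int -> circle R := \val x.
Coercion Omega_coord : Omega >-> Funclass.

Definition bishift (R : realType) (x : bisequence R) : bisequence R :=
  fun n => x (n + 1).

Lemma bishift_kernel (R : realType) (P : {poly int}) (x : Omega R P) :
  bishift (\val x) \in convolution_kernel R P.
Proof.
case: x => x /= /set_mem xP; apply: mem_set => i.
by rewrite -[RHS](xP (i + 1)); apply: eq_bigr => j _; rewrite /bishift addrAC.
Qed.

Definition Omega_shift (R : realType) (P : {poly int}) (x : Omega R P) : Omega R P :=
  exist _ (bishift (\val x)) (bishift_kernel x).

Definition topgroup_isomorphism (G H : topologicalZmodType) (f : G -> H) :=
  {morph f : x y / x + y} /\
  exists g : H -> G, [/\ cancel f g, cancel g f, continuous f & continuous g].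

Definition automorphism (R : realType) (P : {poly int})
    (phi : Omega R P -> Omega R P) :=
  topgroup_isomorphism phi /\ phi \o @Omega_shift R P =1 @Omega_shift R P \o phi.

(* "(y_n; n >= 0) is determined by (x_n; n >= 0)" is functional dependence:
   points that agree on n >= 0 have images that agree on n >= 0. *)
Definition strong_automorphism (R : realType) (P : {poly int})
    (phi : Omega R P -> Omega R P) :=
  automorphism phi /\
  forall x x' : Omega R P,
    (forall n : int, 0 <= n -> x n = x' n) <->
    (forall n : int, 0 <= n -> phi x n = phi x' n).

(* Meant for size P = k.+1 and P`_0 = 1; the last row is (- P`_k, ..., - P`_1). *)
Definition companion (k : nat) (P : {poly int}) : 'M[int]_k :=
  \matrix_(i < k, j < k)
    if i.+1 == k then - P`_(k - j) else (j == i.+1 :> nat)%:R.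

Definition torus_act (R : realType) (k : nat) (B : 'M[int]_k)
    (v : 'cV[circle R]_k) : 'cV[circle R]_k :=
  \col_i \sum_j v j 0 *~ B i j.

(* (x_n, x_(n+1), ..., x_(n+k-1))^T *)
Definition window (R : realType) (P : {poly int}) (k : nat) (x : Omega R P)
    (n : int) : 'cV[circle R]_k :=
  \col_(i < k) x (n + i%:Z).

(* Main.v *)
(* A point of Omega_P on n >= 0 amounts to its window at 0, which ranges over
   all of T^k because M_P is invertible over R (its determinant is +-a_k).  Hence
   a strong automorphism phi induces an automorphism of the group T^k.  Along a
   coordinate axis, t |-> (pi(M_P^n (t e_j)))_n is a continuous homomorphism
   R -> Omega_P, so each coordinate of phi yields a continuous homomorphism
   R -> T killing 1, that is t |-> pi(t b) with b an integer; these integers form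
   B.  Integer matrices act faithfully on T^k, so applying the same to phi^-1
   shows that B is invertible, and shift-equivariance that B commutes with
   M_P. *)
Require Import Defs.
From mathcomp Require Import all_boot all_order all_algebra zify lra.
From mathcomp Require Import generic_quotient ring_quotient.
From mathcomp Require Import all_classical reals topology normedtype unstable.

Set Implicit Arguments.
Unset Strict Implicit.
Unset Printing Implicit Defensive.

Import Order.TTheory GRing.Theory Num.Theory numFieldNormedType.Exports.

Local Open Scope classical_set_scope.
Local Open Scope ring_scope.
Local Open Scope quotient_scope.

(** * Small lifts and continuous characters of the circle *)

Section Circle.
Variable R : realType.
Implicit Types (r s t b : R) (a : circle R).
Local Notation pi r := (\pi_(circle R) r).

Lemma circle_piD r s : pi (r + s) = pi r + pi s.
Proof. exact: raddfD. Qed.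

Lemma circle_piB r s : pi (r - s) = pi r - pi s.
Proof. exact: raddfB. Qed.

Lemma circle_pi0 : pi 0 = 0.
Proof. exact: raddf0. Qed.

Lemma circle_piMn r n : pi (r *+ n) = pi r *+ n.
Proof. exact: raddfMn. Qed.

Lemma circle_pi_eq0 r : (pi r = 0) <-> r \is a Num.int.
Proof.
rewrite -circle_pi0.
rewrite -[r in X in _ <-> X]subr0.
split=> [/eqP|H]; first by rewrite -Quotient.idealrBE.
by apply/eqP; rewrite -Quotient.idealrBE.
Qed.

Lemma circle_pi_intr (m : int) : pi m%:~R = 0.
Proof. by apply/circle_pi_eq0; exact: intr_int. Qed.

Lemma circle_pi_mulz r (m : int) : pi (r * m%:~R) = pi r *~ m.
Proof. by rewrite mulrzr raddfMz. Qed.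

Lemma circle_pi_continuous : continuous (fun r : R => pi r).
Proof. by move=> r U; exact: (pi_continuous (Q0 := circle R)). Qed.

Lemma circle_pi_ball_nbhs (e : R) : 0 < e ->
  nbhs (0 : circle R) [set pi r | r in [set r | `|r| < e]].
Proof.
move=> e0; rewrite -circle_pi0.
apply: circle_pi_nbhs; apply/nbhs_ballP; exists e => //= r.
by rewrite /ball /= sub0r normrN.
Qed.

(** The difference is an integer of absolute value below 1. *)
Lemma circle_pi_small_inj r s :
  pi r = pi s -> `|r - s| < 1 -> r = s.
Proof.
move=> /eqP; rewrite -subr_eq0 -circle_piB => /eqP/circle_pi_eq0 rs_int.
rewrite ltNge; apply: contraNeq; rewrite -subr_eq0.
exact: norm_intr_ge1.
Qed.

(** The small lift [c n] of [a *+ n] is additive in [n]: [c n.+1] and [c 1 + c n] have the same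
    image and differ by less than 3/4. Hence [c n] is [n] times [c 1], which stays bounded only if
    [c 1] is 0. *)
Lemma circle_no_small_subgroup a :
  (forall n : nat, exists2 r, `|r| < 1 / 4 & a *+ n = pi r) -> a = 0.
Proof.
move=> /(_ _)/cid2 a_rep.
pose c n := s2val (a_rep n).
have cs n : `|c n| < 1 / 4 by rewrite /c; case: (a_rep n).
have ca n : a *+ n = pi (c n) by rewrite /c; case: (a_rep n).
have cn n : c n = c 1 *+ n.
  elim: n => [|n IHn].
    apply: circle_pi_small_inj; first by rewrite -ca !mulr0n circle_pi0.
    by move: (cs 0); rewrite mulr0n !ltr_norml; lra.
  rewrite mulrS -IHn; apply: circle_pi_small_inj.
    by rewrite circle_piD -!ca mulrS.
  by move: (cs n.+1) (cs 1) (cs n); rewrite !ltr_norml; lra.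
suff c0 : c 1 = 0 by rewrite -[a]mulr1n ca c0 circle_pi0.
apply/eqP; apply/negP => /negP; rewrite -normr_gt0 => c1.
have := cs (Num.bound (`|c 1|^-1)).
(* For this [n], larger than the inverse of [|c 1|], the lift [c n] has absolute value above 1. *)
rewrite cn normrMn -mulr_natr.
have := ltr_norm_bound (`|c 1|^-1); rewrite normfV normr_id.
rewrite -(ltr_pM2l c1) mulfV ?gt_eqF//; lra.
Qed.

(* With f(t) in pi(-1/8, 1/8) for |t| <= 1/N, take b := N c where c is the
   small lift of f(1/N).  Then f - pi(b .) is 1/N-periodic with values in
   pi(-1/4, 1/4), and a subgroup that small is trivial. *)
Lemma circle_continuous_character (f : R -> circle R) :
  {morph f : s t / s + t} -> continuous f -> f 1 = 0 ->
  exists m : int, forall t, f t = pi (t * m%:~R).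
Proof.
move=> fD fc f1.
have f0 : f 0 = 0 by apply: (addrI (f 0)); rewrite -fD !addr0.
have fMn n t : f (t *+ n) = f t *+ n.
  by elim: n => [|n IHn]; rewrite ?mulr0n // !mulrS fD IHn.
have /nbhs_ballP[e /= e0 fe] : nbhs (0 : R)
    [set t | exists2 r, `|r| < 1 / 8 & pi r = f t].
  have := fc 0 [set pi r | r in [set r | `|r| < 1 / 8]].
  by rewrite f0; apply; apply: circle_pi_ball_nbhs; lra.
pose N := Num.bound e^-1.
have N0 : 0 < N%:R :> R.
  by apply: le_lt_trans (ltr_norm_bound _); exact: normr_ge0.
have Ne : N%:R^-1 < e.
  rewrite -[e]invrK ltf_pV2 ?posrE ?invr_gt0//.
  exact: le_lt_trans (ler_norm _) (ltr_norm_bound _).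
have fN t : `|t| <= N%:R^-1 -> exists2 r, `|r| < 1 / 8 & pi r = f t.
  move=> tN; apply: fe; rewrite /ball /= sub0r normrN.
  exact: le_lt_trans Ne.
have [|c cs cf] := fN N%:R^-1; first by rewrite ger0_norm// ltW// invr_gt0.
(* Multiplying [f(1/N)] by [N] gives [f 1 = 0], so the slope [N c] is an integer [m]. *)
have : pi (c * N%:R) = 0.
  rewrite mulr_natr circle_piMn cf -fMn -[_ *+ N]mulr_natr mulVf ?gt_eqF//.
move=> /circle_pi_eq0/intrP[m cNm]; exists m => t.
have cE : c = N%:R^-1 * m%:~R by rewrite -cNm mulrC mulfK ?gt_eqF.
pose h s := f s - pi (s * m%:~R).
have hD : {morph h : s t / s + t}.
  by move=> s u; rewrite /h fD mulrDl circle_piD opprD addrACA.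
have h0 : h 0 = 0 by apply: (addrI (h 0)); rewrite -hD !addr0.
have hMn n s : h (s *+ n) = h s *+ n.
  by elim: n => [|n IHn]; rewrite ?mulr0n // !mulrS hD IHn.
have hN : h N%:R^-1 = 0 by rewrite /h -cE -cf subrr.
have hMz (j : int) : h (N%:R^-1 * j%:~R) = 0.
  rewrite mulrzr; case: j => n; first by rewrite -pmulrn hMn hN mul0rn.
  apply: (addrI (h (N%:R^-1 *+ n.+1))).
  by rewrite NegzE mulrNz -hD subrr h0 hMn hN mul0rn addr0.
suff : h t = 0 by move=> /eqP; rewrite subr_eq0 => /eqP.
(* Multiples of values of [h] are again values of [h], so it suffices to find a small lift of [h t]
   for every [t]. *)
apply: circle_no_small_subgroup => n; rewrite -hMn.
move: (t *+ n) => {}t.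
pose j := Num.floor (t * N%:R); pose s := t - N%:R^-1 * j%:~R.
have -> : h t = h s.
  by rewrite -[t in LHS](subrK (N%:R^-1 * j%:~R)) hD hMz addr0.
have sN : `|s| <= N%:R^-1.
  have sE : s = N%:R^-1 * (t * N%:R - j%:~R).
    by rewrite mulrBr mulrC mulfK ?gt_eqF.
  have /andP[j1 j2] := Num.Theory.floor_itv (t * N%:R).
  have d0 : 0 <= t * N%:R - j%:~R by rewrite subr_ge0.
  have d1 : t * N%:R - j%:~R <= 1.
    by rewrite lerBlDl ltW//; move: j2; rewrite intrD.
  rewrite sE ger0_norm ?mulr_ge0 ?invr_ge0 ?(ltW N0)//.
  by rewrite ler_piMr ?invr_ge0 ?(ltW N0).
have [r rs rf] := fN s sN.
exists (r - s * m%:~R); last by rewrite /h -rf circle_piB.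
(* Since [c = m / N] and [|s| <= 1 / N], the product is at most [|c|]; the bounds 1/8 on both terms
   add up to 1/4. *)
have : `|s * m%:~R| < 1 / 8.
  apply: le_lt_trans cs; rewrite cE !normrM ler_wpM2r//.
  by rewrite [leRHS]ger0_norm ?invr_ge0 ?(ltW N0).
by move: rs; rewrite !ltr_norml; lra.
Qed.

End Circle.

(** * Integer matrices acting on the torus *)

Section TorusAction.
Variables (R : realType) (k : nat).
Implicit Types (B C : 'M[int]_k) (v : 'cV[circle R]_k) (u : 'cV[R]_k).
Local Notation pi r := (\pi_(circle R) r).

Lemma torus_act_pi B u :
  torus_act B (map_mx (fun r => pi r) u) =
  map_mx (fun r => pi r) (map_mx intr B *m u).
Proof.
apply/colP => i; rewrite !mxE (big_morph _ (@circle_piD R) (@circle_pi0 R)).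
by apply: eq_bigr => j _; rewrite !mxE mulrC circle_pi_mulz.
Qed.

Lemma torus_lift v : exists u, map_mx (fun r => pi r) u = v.
Proof.
exists (map_mx (fun a : circle R => repr a) v).
by apply/colP => i; rewrite !mxE reprK.
Qed.

Lemma torus_act1 v : torus_act 1%:M v = v.
Proof.
by have [u <-] := torus_lift v; rewrite torus_act_pi map_mx1 mul1mx.
Qed.

Lemma torus_actM B C v : torus_act (B *m C) v = torus_act B (torus_act C v).
Proof.
by have [u <-] := torus_lift v; rewrite !torus_act_pi map_mxM mulmxA.
Qed.

(** If an entry [d] of the difference were nonzero, testing on real multiples [r] of a basis vector
    would make every [r d] an integer; [r = 1 / (2 d)] contradicts this. *)
Lemma torus_act_faithful B C :
  (forall v, torus_act B v = torus_act C v) -> B = C.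
Proof.
move=> BC; apply/matrixP => i j; apply/eqP; rewrite -subr_eq0.
set d := _ - _; apply/negP => /negP d0.
have dr (r : R) : pi (r * d%:~R) = 0.
  have := BC (map_mx (fun r => pi r) (r *: delta_mx j 0)).
  rewrite !torus_act_pi => /colP/(_ i); rewrite -!scalemxAr -!colE !mxE => rBC.
  by rewrite /d intrD mulrDr rmorphN mulrN circle_piB rBC subrr.
have dR : d%:~R != 0 :> R by rewrite intr_eq0.
have /circle_pi_small_inj : pi (1 / 2) = pi 0.
  by rewrite circle_pi0 -(dr (1 / 2 / d%:~R)) divfK.
by rewrite subr0 ger0_norm; [move=> H; have := H ltac:(lra); lra | lra].
Qed.

End TorusAction.

(** * Continuity of maps into the circle and into and out of [Omega] *)

Section Continuity.
Variable R : realType.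

Lemma circle_continuousD (X : topologicalType) (f g : X -> circle R) :
  continuous f -> continuous g -> continuous (fun x => f x + g x).
Proof.
move=> cf cg x.
have -> : (fun x => f x + g x) =
  (fun z : circle R * circle R => z.1 + z.2) \o (fun x => (f x, g x)) by [].
apply: cvg_comp (cvg_pair (cf x) (cg x)) _.
exact: (@add_continuous (circle R) (f x, g x)).
Qed.

Lemma circle_continuousMz (X : topologicalType) (f : X -> circle R) (m : int) :
  continuous f -> continuous (fun x => f x *~ m).
Proof.
move=> cf; have cMn n : continuous (fun x => f x *+ n).
  elim: n => [|n IHn]; first exact: cst_continuous.
  under [fun x => _]eq_fun do rewrite mulrS.
  exact: circle_continuousD.
case: m => n; first exact: cMn.
move=> x; rewrite NegzE.
under [fun x => _]eq_fun do rewrite mulrNz.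
by apply: cvg_comp (cMn n.+1 x) _; exact: opp_continuous.
Qed.

Lemma circle_continuous_sum (X : topologicalType) (I : Type) (s : seq I)
    (f : I -> X -> circle R) :
  (forall i, continuous (f i)) -> continuous (fun x => \sum_(i <- s) f i x).
Proof.
move=> cf; elim: s => [|i s IHs].
  under [fun x => _]eq_fun do rewrite big_nil.
  exact: cst_continuous.
under [fun x => _]eq_fun do rewrite big_cons.
exact: circle_continuousD.
Qed.

Lemma Omega_continuousP (P : {poly int}) (X : topologicalType)
    (f : X -> Omega R P) :
  (forall n, continuous (fun x => f x n)) -> continuous f.
Proof.
move=> cf; apply: (@continuous_comp_initial _ _ _ (fun x : Omega R P => \val x)).
exact: (@bisequence_continuousP R X (fun x => \val (f x))).
Qed.

Lemma Omega_coord_continuous (P : {poly int}) n :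
  continuous (fun x : Omega R P => x n).
Proof.
move=> x.
have valc : (fun x : Omega R P => \val x) @ x --> \val x.
  exact: (@initial_continuous _ _ (set_val : Omega R P -> bisequence R)).
have -> : (fun x : Omega R P => x n) =
  (fun x : bisequence R => x n) \o (fun x : Omega R P => \val x) by [].
by apply: cvg_comp valc _; exact: (@bisequence_coord_continuous R n (\val x)).
Qed.

End Continuity.

(** * Points of [Omega] as bi-infinite orbits of the companion matrix *)

Section Omega.
Variables (R : realType) (k : nat) (P : {poly int}).
Hypotheses (P_deg : size P = k.+2) (P_cst : P`_0 = 1).
Local Notation pi r := (\pi_(circle R) r).
Local Notation M := (companion k.+1 P).
Local Notation window := (window k.+1).
Implicit Types (x y : Omega R P) (v : 'cV[circle R]_k.+1) (B : 'M[int]_k.+1).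

Lemma Omega_ext x y : (forall n, x n = y n) -> x = y.
Proof. by move=> xy; apply/val_inj/funext. Qed.

Lemma Omega_addE x y n : (x + y : Omega R P) n = x n + y n.
Proof. by rewrite /Omega_coord raddfD. Qed.

Lemma Omega_zeroE n : (0 : Omega R P) n = 0.
Proof. by rewrite /Omega_coord raddf0. Qed.

Lemma windowD x y n : window (x + y) n = window x n + window y n.
Proof. by apply/colP => i; rewrite !mxE Omega_addE. Qed.

Lemma window_coord x n : window x n ord0 0 = x n.
Proof. by rewrite mxE addr0. Qed.

Lemma window_ext x y : (forall n, window x n = window y n) -> x = y.
Proof. by move=> xy; apply: Omega_ext => n; rewrite -!window_coord xy. Qed.

Lemma companion_act_lt v (i : 'I_k.+1) : (i < k)%N ->
  torus_act M v i 0 = v (inord i.+1) 0.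
Proof.
move=> ik; rewrite mxE (bigD1 (inord i.+1)) //= big1 => [|j ji].
  by rewrite mxE eqSS ltn_eqF // inordK // eqxx addr0.
rewrite mxE eqSS ltn_eqF //.
suff -> : (j == i.+1 :> nat) = false by rewrite mulr0z.
by apply: contraNF ji => /eqP ji; apply/eqP/val_inj; rewrite /= inordK.
Qed.

Lemma companion_act_max v :
  torus_act M v ord_max 0 = - \sum_(j < k.+1) v j 0 *~ P`_(k.+1 - j).
Proof.
by rewrite mxE -sumrN; apply: eq_bigr => j _; rewrite mxE eqxx mulrNz.
Qed.

Lemma convolutionE (y : int -> circle R) (n : int) :
  \sum_(j < size P) y (n + k.+1%:Z - j%:Z) *~ P`_j =
  y (n + k.+1%:Z) + \sum_(j < k.+1) y (n + j%:Z) *~ P`_(k.+1 - j).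
Proof.
rewrite P_deg big_ord_recl subr0 P_cst; congr (_ + _).
rewrite (reindex_inj rev_ord_inj); apply: eq_bigr => j _ /=.
rewrite /bump /= add1n subSS subSn; last by rewrite -ltnS.
by congr (y _ *~ _); rewrite -addrA; congr (_ + _); have := ltn_ord j; lia.
Qed.

Lemma window_step x n : window x (n + 1) = torus_act M (window x n).
Proof.
apply/colP => i; have [ik|] := boolP (i < k)%N.
  rewrite companion_act_lt // !mxE inordK // -addrA.
  by congr (Omega_coord x (_ + _)); lia.
rewrite -leqNgt => ki; have -> : i = ord_max.
  by apply/val_inj/eqP; rewrite eqn_leq ki -ltnS ltn_ord.
rewrite companion_act_max mxE; apply/eqP; rewrite -addr_eq0.
have := set_mem (valP x) (n + k.+1%:Z); rewrite convolutionE => /eqP.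
rewrite -addrA (_ : 1 + _ = k.+1%:Z); last by rewrite /=; lia.
by under [X in _ -> is_true (_ + X == 0)]eq_bigr do rewrite mxE.
Qed.

(** The point is read off from the first entries of [W]: the superdiagonal rows identify entry [i]
    of [W n] with the first entry of [W (n + i)], and the last row is the recurrence. This is the
    means of constructing points of [Omega]. *)
Lemma Omega_orbit (W : int -> 'cV[circle R]_k.+1) :
  (forall n, W (n + 1) = torus_act M (W n)) ->
  exists x, forall n, window x n = W n.
Proof.
move=> WM; pose y : bisequence R := fun n => W n ord0 0.
have Wy n (i : 'I_k.+1) : W n i 0 = y (n + i%:Z).
  case: i => i; elim: i n => [|i IHi] n ik.
    by rewrite addr0; congr (W n _ 0); apply/val_inj.
  have ik' := ltnW ik; have -> : Ordinal ik = inord i.+1.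
    by apply/val_inj; rewrite /= inordK.
  have := companion_act_lt (W n) (i := Ordinal ik') ik => /= <-.
  by rewrite -WM IHi -addrA; congr (y (_ + _)); rewrite /= inordK //; lia.
have yP : y \in convolution_kernel R P.
  apply: mem_set => n; rewrite -[n](subrK k.+1%:Z) convolutionE.
  apply/eqP; rewrite addr_eq0; move: (n - _) => {}n.
  have := companion_act_max (W n); rewrite -WM Wy.
  rewrite -addrA (_ : 1 + _ = k.+1%:Z); last by rewrite /=; lia.
  by move=> ->; under eq_bigr do rewrite Wy.
exists (exist _ y yP) => n.
by apply/colP => i; rewrite Wy mxE.
Qed.

(** Only forward in time: [M] need not be injective on the torus when its determinant, up to sign
    the leading coefficient, is not a unit. *)
Lemma window_determined x y :
  window x 0 = window y 0 -> forall n : int, 0 <= n -> window x n = window y n.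
Proof.
move=> xy [n|//] _; elim: n => [//|n IHn].
by rewrite intS addrC !window_step IHn.
Qed.

Local Notation A := (map_mx intr M : 'M[R]_k.+1).

(** For a vector in the kernel, the superdiagonal rows annihilate every coordinate but the first;
    the last row then annihilates the first, the leading coefficient being nonzero. *)
Lemma companion_unit : A \in unitmx.
Proof.
rewrite -unitmx_tr -row_free_unit; apply: inj_row_free => v /rowP vA.
have rowA i : \sum_j v 0 j * (M i j)%:~R = 0.
  have := vA i; rewrite !mxE.
  by under eq_bigr do rewrite [A^T _ _]mxE [A _ _]mxE.
have vS (i : 'I_k.+1) : i != ord0 -> v 0 i = 0.
  case: i => -[//|i] ik _.
  have := rowA (inord i); rewrite (bigD1 (Ordinal ik)) //= big1 => [|j ji].
    by rewrite mxE inordK ?(ltnW ik) // eqSS ltn_eqF //= eqxx mulr1 addr0.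
  rewrite mxE inordK ?(ltnW ik) // eqSS ltn_eqF //.
  suff -> : (j == i.+1 :> nat) = false by rewrite mulr0.
  by apply: contraNF ji => /eqP ji; apply/eqP/val_inj.
have v0 : v 0 ord0 = 0.
  have := rowA ord_max; rewrite (bigD1 ord0) //= big1 => [|j /vS ->]; last first.
    by rewrite mul0r.
  rewrite addr0 mxE eqxx subn0 => /eqP; rewrite mulf_eq0 intr_eq0 oppr_eq0.
  suff /negPf -> : P`_k.+1 != 0 by rewrite orbF => /eqP.
  have := lead_coef_eq0 P; rewrite lead_coefE P_deg /= => ->.
  by rewrite -size_poly_gt0 P_deg.
apply/rowP => i; rewrite mxE.
by have [->|/vS] := eqVneq i ord0.
Qed.

(** Negative powers of the companion matrix exist over the reals, so a real lift of a window selects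
    one of its possible pasts. *)
Lemma Omega_flow (u : 'cV[R]_k.+1) :
  exists x, forall n, window x n = map_mx (fun r => pi r) (A ^ n *m u).
Proof.
apply: Omega_orbit => n; rewrite torus_act_pi mulmxA; congr (map_mx _ (_ *m _)).
by rewrite addrC exprzDr ?expr1z ?mulmxE //; exact: companion_unit.
Qed.

Lemma window_surj v : exists x, window x 0 = v.
Proof.
have [u <-] := torus_lift v; have [x xu] := Omega_flow u.
by exists x; rewrite xu expr0z mul1mx.
Qed.

(* A continuous endomorphism factoring through the window at 0 is a continuous
   character on each coordinate line t |-> pi(A^n (t e_j)). *)
Lemma endomorphism_matrix (psi : Omega R P -> Omega R P) :
  {morph psi : x y / x + y} -> continuous psi ->
  (forall x, (forall n : int, 0 <= n -> x n = 0) ->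
     forall n : int, 0 <= n -> psi x n = 0) ->
  exists B, forall x, window (psi x) 0 = torus_act B (window x 0).
Proof.
move=> psiD psic psi_det.
have psi0 : psi 0 = 0 by apply: (addrI (psi 0)); rewrite -psiD !addr0.
(* By additivity it is enough to look at [x - y], which vanishes at all non-negative times. *)
have psiW x y : window x 0 = window y 0 -> window (psi x) 0 = window (psi y) 0.
  move=> xy; rewrite -[x](subrK y) psiD windowD.
  suff -> : window (psi (x - y)) 0 = 0 by rewrite add0r.
  apply/colP => i; rewrite [LHS]mxE [RHS]mxE psi_det // => m m0.
  apply: (addIr (y m)); rewrite -Omega_addE subrK add0r.
  by rewrite -!window_coord (window_determined xy).
have /choice[gamma gammaE] := Omega_flow.
(* All windows of [gamma u] are prescribed, so the chosen points depend additively on [u]. *)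
have gammaD : {morph gamma : u w / u + w}.
  move=> u w; apply: window_ext => n; rewrite windowD !gammaE mulmxDr.
  by apply/colP => i; rewrite !mxE circle_piD.
have gamma0 u : window (gamma u) 0 = map_mx (fun r => pi r) u.
  by rewrite gammaE expr0z mul1mx.
pose chi (i : 'I_k.+1) u := psi (gamma u) i%:Z.
have chiD i : {morph chi i : u w / u + w}.
  by move=> u w; rewrite /chi gammaD psiD Omega_addE.
have chi0 i : chi i 0 = 0 by apply: (addrI (chi i 0)); rewrite -chiD !addr0.
have /choice[b bE] (ij : 'I_k.+1 * 'I_k.+1) :
    exists m : int, forall t, chi ij.1 (t *: delta_mx ij.2 0) = pi (t * m%:~R).
  case: ij => i j /=; apply: circle_continuous_character.
  - by move=> s t; rewrite scalerDl chiD.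
  - have gc : continuous (fun t : R => gamma (t *: delta_mx j 0)).
      apply: Omega_continuousP => n.
      have -> : (fun t : R => gamma (t *: delta_mx j 0) n) =
          (fun r => pi r) \o (fun t : R => t * (A ^ n) ord0 j).
        apply/funext => t.
        by rewrite -window_coord gammaE mxE -scalemxAr -colE !mxE.
      move=> t; apply: continuous_comp; last exact: circle_pi_continuous.
      exact: mulrr_continuous.
    move=> t; rewrite /chi.
    have -> : (fun t : R => psi (gamma (t *: delta_mx j 0)) i) =
      (fun x : Omega R P => x i) \o
        (psi \o (fun t : R => gamma (t *: delta_mx j 0))) by [].
    apply: continuous_comp; last exact: Omega_coord_continuous.
    by apply: continuous_comp; [exact: gc|exact: psic].
  (* The character kills 1: a standard basis vector has integer entries, so its flow has zero window
     at 0. *)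
  - have : window (psi (gamma (1 *: delta_mx j 0))) 0 = window (psi 0) 0.
      apply: psiW; rewrite gamma0; apply/colP => l.
      by rewrite !mxE Omega_zeroE mul1r eqxx andbT -(circle_pi_intr R (l == j)).
    by move=> /colP/(_ i); rewrite psi0 !mxE Omega_zeroE add0r.
exists (\matrix_(i, j) b (i, j)) => x.
have [u ux] := torus_lift (window x 0).
rewrite (psiW x (gamma u)); last by rewrite gamma0.
apply/colP => i; rewrite !mxE -ux add0r.
have uE : u = \sum_j u j 0 *: delta_mx j 0.
  apply/colP => i'; rewrite summxE (bigD1 i') //= big1 => [|j ji].
    by rewrite !mxE !eqxx mulr1 addr0.
  by rewrite !mxE eq_sym (negPf ji) mulr0.
rewrite -[LHS]/(chi i u) [in LHS]uE (big_morph _ (chiD i) (chi0 i)).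
by apply: eq_bigr => j _; rewrite (bE (i, j)) !mxE circle_pi_mulz.
Qed.

End Omega.

(** * Strong automorphisms and unimodular matrices commuting with [M] *)

Section Automorphisms.
Variables (R : realType) (k : nat) (P : {poly int}).
Hypotheses (P_deg : size P = k.+2) (P_cst : P`_0 = 1).
Local Notation M := (companion k.+1 P).
Local Notation window := (window k.+1).
Implicit Types (x y : Omega R P) (B : 'M[int]_k.+1).
Implicit Types (f phi : Omega R P -> Omega R P).

Definition acts_on_windows B f :=
  forall x n, window (f x) n = torus_act B (window x n).

Lemma window_shift x n : window (Omega_shift x) n = window x (n + 1).
Proof.
apply/colP => i; rewrite !mxE /Omega_coord /= /bishift.
by rewrite addrAC.
Qed.

Lemma window_eq_ge0 x y :
  (forall n : int, 0 <= n -> x n = y n) <-> window x 0 = window y 0.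
Proof.
split=> [xy|xy n n0]; first by apply/colP => i; rewrite !mxE xy ?add0r.
by rewrite -!(window_coord k) (window_determined P_deg P_cst xy).
Qed.

(** A matrix commuting with [M] maps orbits of [M] to orbits of [M]. *)
Lemma commuting_matrix_acts B : B *m M = M *m B ->
  exists f, acts_on_windows B f.
Proof.
move=> BM; suff /choice[f fE] : forall x, exists y, forall n,
    window y n = torus_act B (window x n) by exists f.
move=> x; apply: Omega_orbit => // n.
by rewrite window_step // -!torus_actM BM.
Qed.

Lemma acts_on_windowsD B f : acts_on_windows B f -> {morph f : x y / x + y}.
Proof.
move=> fB x y; apply: (@window_ext R k P) => n; rewrite windowD !fB windowD.
apply/colP => i; rewrite !mxE -big_split /=.
by apply: eq_bigr => j _; rewrite mxE mulrzDl.
Qed.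

Lemma acts_on_windows_continuous B f : acts_on_windows B f -> continuous f.
Proof.
move=> fB; apply: Omega_continuousP => n.
have -> : (fun x => f x n) =
    (fun x => \sum_(j < k.+1) x (n + j%:Z) *~ B ord0 j).
  apply/funext => x; rewrite -(window_coord k) fB mxE.
  by apply: eq_bigr => j _; rewrite mxE.
apply: circle_continuous_sum => j; apply: circle_continuousMz.
exact: Omega_coord_continuous.
Qed.

Lemma acts_on_windows_shift B f : acts_on_windows B f ->
  f \o @Omega_shift R P =1 @Omega_shift R P \o f.
Proof.
move=> fB x; apply: (@window_ext R k P) => n /=.
by rewrite window_shift !fB window_shift.
Qed.

Lemma unimodular_unitmx B : (\det B = 1 \/ \det B = -1) <-> B \in unitmx.
Proof.
rewrite unitmxE; split=> [[->|->]//|/orP[] /eqP ->]; first by left.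
by right.
Qed.

(** The inverse of [B] is again an integer matrix commuting with [M], and the map it induces is the
    continuous inverse of [f]. *)
Lemma unimodular_strong_automorphism B f :
  B \in unitmx -> B *m M = M *m B -> acts_on_windows B f ->
  strong_automorphism f.
Proof.
move=> Bu BM fB.
have [g gB] : exists g, acts_on_windows (invmx B) g.
  apply: commuting_matrix_acts.
  by rewrite -[LHS](mulmxK Bu) -(mulmxA (invmx B)) -BM mulKmx.
have fK : cancel f g.
  move=> x; apply: (@window_ext R k P) => n.
  by rewrite gB fB -torus_actM mulVmx // torus_act1.
have gK : cancel g f.
  move=> x; apply: (@window_ext R k P) => n.
  by rewrite fB gB -torus_actM mulmxV // torus_act1.
split; first (split; last exact: acts_on_windows_shift fB).
  split; first exact: acts_on_windowsD fB.
  exists g; split=> //; [exact: acts_on_windows_continuous fB|].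
  exact: acts_on_windows_continuous gB.
move=> x x'; rewrite !window_eq_ge0 !fB.
split=> [-> //|xx'].
by rewrite -[LHS]torus_act1 -[RHS]torus_act1 -(mulVmx Bu) !torus_actM xx'.
Qed.

Lemma shift_iter f x p : f \o @Omega_shift R P =1 @Omega_shift R P \o f ->
  f (iter p (@Omega_shift R P) x) = iter p (@Omega_shift R P) (f x).
Proof. by move=> fs; elim: p => [//|p IHp] /=; rewrite -IHp -[RHS]fs. Qed.

Lemma window_shift_iter x p n :
  window (iter p (@Omega_shift R P) x) n = window x (n + p%:Z).
Proof.
elim: p n => [|p IHp] n /=; first by rewrite addr0.
by rewrite window_shift IHp -addrA intS.
Qed.

(** Time [n >= 0] reduces to time 0 by shifting. For negative times, [x] is first written as an
    iterated shift of a point [y], obtained by delaying its windows. *)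
Lemma shift_equivariant_acts B f :
  f \o @Omega_shift R P =1 @Omega_shift R P \o f ->
  (forall x, window (f x) 0 = torus_act B (window x 0)) -> acts_on_windows B f.
Proof.
move=> fs fB x.
have ge0 y (p : nat) : window (f y) p = torus_act B (window y p).
  by rewrite -[p%:Z]add0r -!window_shift_iter -shift_iter.
move=> [//|p].
have [y yx] : exists y, forall n, window y n = window x (n + Negz p).
  by apply: Omega_orbit => // n; rewrite -window_step // addrAC.
have <- : iter p.+1 (@Omega_shift R P) y = x.
  apply: (@window_ext R k P) => n.
  by rewrite window_shift_iter yx NegzE addrK.
by rewrite shift_iter // !window_shift_iter NegzE addNr ge0.
Qed.

(** Both products send the window of [x] at 0 to the window of [f x] at 1, and windows at 0 fill the
    torus. *)
Lemma acts_on_windows_commute B f : acts_on_windows B f -> B *m M = M *m B.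
Proof.
move=> fB; apply: (@torus_act_faithful R) => v.
have [x <-] := window_surj P_deg P_cst v.
by rewrite !torus_actM -window_step // -fB window_step // fB.
Qed.

Lemma strong_automorphism_matrix phi : strong_automorphism phi ->
  exists2 B, B \in unitmx & acts_on_windows B phi.
Proof.
move=> [[[phiD [g [phiK gK phic gc]]] phis] phi_det].
have gD : {morph g : x y / x + y}.
  by move=> x y; apply: (can_inj phiK); rewrite phiD !gK.
have phi0 : phi 0 = 0 by apply: (addrI (phi 0)); rewrite -phiD !addr0.
have [|B phiB] := endomorphism_matrix P_deg P_cst phiD phic.
  move=> x x0 n n0; rewrite -(Omega_zeroE R P n) -phi0.
  by apply: (phi_det x 0).1 => // m m0; rewrite x0 ?Omega_zeroE.
(* The converse half of the strong condition, at [g x] and 0, is the same vanishing property for the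
   inverse. *)
have [|C gC] := endomorphism_matrix P_deg P_cst gD gc.
  move=> x x0 n n0; rewrite -(Omega_zeroE R P n).
  apply: (phi_det (g x) 0).2 => // m m0.
  by rewrite gK phi0 x0 ?Omega_zeroE.
exists B; last exact: shift_equivariant_acts.
suff /mulmx1_unit[] : B *m C = 1%:M by [].
apply: (@torus_act_faithful R) => v.
have [x <-] := window_surj P_deg P_cst v.
by rewrite torus_actM torus_act1 -gC -phiB gK.
Qed.

End Automorphisms.

Theorem theorem4 (R : realType) (k : nat) (P : {poly int})
  (k_ge1 : (1 <= k)%N) (P_deg : size P = k.+1) (P_cst : P`_0 = 1)
  (phi : Omega R P -> Omega R P) :
  strong_automorphism phi <->
  exists B : 'M[int]_k,
    [/\ \det B = 1 \/ \det B = -1,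
        B *m companion k P = companion k P *m B &
        forall (x : Omega R P) (n : int),
          window k (phi x) (n + 1) = torus_act B (window k x (n + 1))].
Proof.
(* From here the degree is [k.+1], as in the sections above. *)
case: k k_ge1 P_deg => // k _ P_deg; split.
  move=> /(strong_automorphism_matrix P_deg P_cst)[B /unimodular_unitmx Bu phiB].
  by exists B; split=> //; exact: acts_on_windows_commute phiB.
move=> [B [/unimodular_unitmx Bu BM phiB]].
apply: unimodular_strong_automorphism Bu BM _ => // x n.
(* The hypothesis speaks of windows at [n + 1], hence it is applied at [n - 1]. *)
by rewrite -[n](subrK 1) phiB.
Qed.
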